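(* Let ${}^{\star}\mathbb{R}$ be the hyperreal number system of Non-Standard Analysis. Then $$RANDOM({}^{\star}\mathbb{R};[0,1])=\{x+\epsilon : x\in RANDOM(0,1),\ \epsilon\in{}^{\star}\mathbb{R}_{infinitesimals}\}.$$
   Context: One works in ZFC together with the Generalized Continuum Hypothesis in the form $2^{\aleph_n}=\aleph_{n+1}$ for all $n\in\mathbb{N}$. The hyperreal number system of Non-Standard Analysis is the ultrapower ${}^{\star}\mathbb{R}=\mathbb{R}^{\mathbb{N}}/\mathcal{F}$ for a nonprincipal ultrafilter $\mathcal{F}$ on $\mathbb{N}$, with the field operations and order induced $\mathcal{F}$-almost everywhere and with $\mathbb{R}$ embedded via constant sequences (under the Continuum Hypothesis it does not depend, up to isomorphism, on $\mathcal{F}$). ${}^{\star}\mathbb{R}_{infinitesimals}=\{x\in{}^{\star}\mathbb{R}: -r<x<r\ \forall r\in\mathbb{R},\ r>0\}$. Intervals $[a,b]$ below are taken in ${}^{\star}\mathbb{R}$. Let $\Sigma=\{0,1\}$, $\Sigma^\star$ the set of binary strings, and $\Sigma^\infty$ the set of binary sequences $\bar{x}=(x_n)_{n\geq1}$. For $a_0<b_0$ in ${}^{\star}\mathbb{R}$ and $\bar{x}\in\Sigma^\infty$, define inductively for $n\geq 1$ (with $a_0(\bar{x})=a_0$, $b_0(\bar{x})=b_0$): if $x_n=0$ then $a_n(\bar{x})=a_{n-1}(\bar{x})$ and $b_n(\bar{x})=\frac{a_{n-1}(\bar{x})+b_{n-1}(\bar{x})}{2}$; if $x_n=1$ then $a_n(\bar{x})=\frac{a_{n-1}(\bar{x})+b_{n-1}(\bar{x})}{2}$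 and $b_n(\bar{x})=b_{n-1}(\bar{x})$. The Dedekind set is $S_{Dedekind}(a_0,b_0;\bar{x})=\{d\in{}^{\star}\mathbb{R}: d\in\bigcap_{n\in\mathbb{N}}[a_n(\bar{x}),b_n(\bar{x})]\}$. $RANDOM(\Sigma^\infty)$ is the set of Martin-Löf–Solovay–Chaitin random binary sequences, i.e. of those sequences belonging to no constructively null set. Here, for $X\subset\Sigma^\star$, $X\Sigma^\infty$ is the set of sequences having some prefix in $X$; a set $S\subset\Sigma^\infty$ is constructively null if there are a recursively enumerable $X\subset\Sigma^\star\times\mathbb{N}$ and sets $G_k=X_k\Sigma^\infty$, $X_k=\{\vec{x}:(\vec{x},k)\in X\}$, $k\geq1$, with $S\subset\bigcap_{k\geq1}G_k$ and $\mu_{Lebesgue}(G_k)\to0$ constructively (with a computable rate), where $\mu_{Lebesgue}$ gives the set of sequences extending a string $\vec{x}$ the measure $2^{-|\vec{x}|}$. $RANDOM(0,1)=\{\sum_{i=1}^\infty x_i2^{-i}:\bar{x}\in RANDOM(\Sigma^\infty)\}\subset[0,1]\cap\mathbb{R}$. The set of random numbers of ${}^{\star}\mathbb{R}$ with respect to $[a_0,b_0]$ is $RANDOM({}^{\star}\mathbb{R};[a_0,b_0])=\{d\in S_{Dedekind}(a_0,b_0;\bar{x}):\bar{x}\in RANDOM(\Sigma^\infty)\}$, i.e. the union of the Dedekind sets over all random $\bar{x}$. *)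

(* Defs.v *)
From HB Require Import structures.
From mathcomp Require Import all_boot all_order all_algebra generic_quotient.
From mathcomp Require Import all_classical all_reals all_analysis.
Import Order.TTheory GRing.Theory Num.Theory numFieldNormedType.Exports.

Set Implicit Arguments.
Unset Strict Implicit.
Unset Printing Implicit Defensive.

Local Open Scope classical_set_scope.
Local Open Scope ring_scope.
Local Open Scope quotient_scope.

Definition nonprincipal (F : set_system nat) : Prop :=
  forall n : nat, F <> principal_filter n.

Section Hyperreal.
Context (R : realType) (F : set_system nat) (FU : UltraFilter F).

Definition ae_eq_seq (f g : nat -> R) : bool :=
  `[< \forall n \near F, f n = g n >].

Lemma ae_eq_seq_refl : reflexive ae_eq_seq.
Proof. by move=> f; apply/asboolP; exact: filterE. Qed.

Lemma ae_eq_seq_sym : symmetric ae_eq_seq.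
Proof.
by move=> f g; apply/asboolP/asboolP; apply: filterS => n.
Qed.

Lemma ae_eq_seq_trans : transitive ae_eq_seq.
Proof.
move=> g f h /asboolP fg /asboolP gh; apply/asboolP.
by apply: filterS2 fg gh => n -> ->.
Qed.

Definition ae_eq_seq_equiv :=
  EquivRel ae_eq_seq ae_eq_seq_refl ae_eq_seq_sym ae_eq_seq_trans.

Definition hyperreal : Type := {eq_quot ae_eq_seq_equiv}.
HB.instance Definition _ := Choice.on hyperreal.
HB.instance Definition _ := EqQuotient.on hyperreal.

Implicit Types (f g : nat -> R) (x y z : hyperreal).

Definition hclass f : hyperreal := \pi_hyperreal f.

Lemma hclass_eq f g : hclass f = hclass g <-> \forall n \near F, f n = g n.
Proof. by split=> [/eqmodP/asboolP|fg]; last exact/eqmodP/asboolP. Qed.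

Lemma hclassW (P : hyperreal -> Prop) :
  (forall f, P (hclass f)) -> forall x, P x.
Proof. by move=> Pf x; rewrite -[x]reprK; exact: Pf. Qed.

Lemma repr_hclass f : \forall n \near F, repr (hclass f) n = f n.
Proof. by apply/hclass_eq; rewrite /hclass reprK. Qed.

Definition hadd x y := hclass (fun n => repr x n + repr y n).
Definition hmul x y := hclass (fun n => repr x n * repr y n).
Definition hopp x := hclass (fun n => - repr x n).
Definition hinv x := hclass (fun n => (repr x n)^-1).
Definition habs x := hclass (fun n => `|repr x n|).
Definition hle x y : bool := `[< \forall n \near F, repr x n <= repr y n >].
Definition hlt x y : bool := `[< \forall n \near F, repr x n < repr y n >].

Lemma hadd_class f g : hadd (hclass f) (hclass g) = hclass (fun n => f n + g n).
Proof.
apply/hclass_eq.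
by apply: filterS2 (repr_hclass f) (repr_hclass g) => n -> ->.
Qed.

Lemma hmul_class f g : hmul (hclass f) (hclass g) = hclass (fun n => f n * g n).
Proof.
apply/hclass_eq.
by apply: filterS2 (repr_hclass f) (repr_hclass g) => n -> ->.
Qed.

Lemma hopp_class f : hopp (hclass f) = hclass (fun n => - f n).
Proof. by apply/hclass_eq; apply: filterS (repr_hclass f) => n ->. Qed.

Lemma hinv_class f : hinv (hclass f) = hclass (fun n => (f n)^-1).
Proof. by apply/hclass_eq; apply: filterS (repr_hclass f) => n ->. Qed.

Lemma habs_class f : habs (hclass f) = hclass (fun n => `|f n|).
Proof. by apply/hclass_eq; apply: filterS (repr_hclass f) => n ->. Qed.

Lemma hle_class f g :
  hle (hclass f) (hclass g) <-> \forall n \near F, f n <= g n.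
Proof.
split=> [/asboolP|] H; last apply/asboolP; move: H;
by apply: filterS3 (repr_hclass f) (repr_hclass g) => n -> ->.
Qed.

Lemma hlt_class f g :
  hlt (hclass f) (hclass g) <-> \forall n \near F, f n < g n.
Proof.
split=> [/asboolP|] H; last apply/asboolP; move: H;
by apply: filterS3 (repr_hclass f) (repr_hclass g) => n -> ->.
Qed.

Let hzero := hclass (fun=> 0).
Let hone := hclass (fun=> 1).

Lemma haddA : associative hadd.
Proof.
elim/hclassW=> f; elim/hclassW=> g; elim/hclassW=> h.
by rewrite !hadd_class; congr hclass; apply/funext=> n; rewrite addrA.
Qed.

Lemma haddC : commutative hadd.
Proof.
elim/hclassW=> f; elim/hclassW=> g.
by rewrite !hadd_class; congr hclass; apply/funext=> n; rewrite addrC.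
Qed.

Lemma hadd0 : left_id hzero hadd.
Proof.
elim/hclassW=> f.
by rewrite hadd_class; congr hclass; apply/funext=> n; rewrite add0r.
Qed.

Lemma haddN : left_inverse hzero hopp hadd.
Proof.
elim/hclassW=> f; rewrite hopp_class hadd_class.
by congr hclass; apply/funext=> n; rewrite addNr.
Qed.

HB.instance Definition _ :=
  GRing.isZmodule.Build hyperreal haddA haddC hadd0 haddN.

Lemma hmulA : associative hmul.
Proof.
elim/hclassW=> f; elim/hclassW=> g; elim/hclassW=> h.
by rewrite !hmul_class; congr hclass; apply/funext=> n; rewrite mulrA.
Qed.

Lemma hmulC : commutative hmul.
Proof.
elim/hclassW=> f; elim/hclassW=> g.
by rewrite !hmul_class; congr hclass; apply/funext=> n; rewrite mulrC.
Qed.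

Lemma hmul1 : left_id hone hmul.
Proof.
elim/hclassW=> f.
by rewrite hmul_class; congr hclass; apply/funext=> n; rewrite mul1r.
Qed.

Lemma hmulDl : left_distributive hmul hadd.
Proof.
elim/hclassW=> f; elim/hclassW=> g; elim/hclassW=> h.
rewrite !(hadd_class, hmul_class); congr hclass.
by apply/funext=> n; rewrite mulrDl.
Qed.

Lemma hone_neq0 : hone != 0 :> hyperreal.
Proof.
by apply/eqP => /hclass_eq /filter_ex[n /eqP]; rewrite oner_eq0.
Qed.

HB.instance Definition _ :=
  GRing.Zmodule_isComNzRing.Build hyperreal hmulA hmulC hmul1 hmulDl hone_neq0.

Lemma hmulVf x : x != 0 -> hinv x * x = 1.
Proof.
elim/hclassW: x => f f0.
have {f0} : F (~` [set n | f n = 0]).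
  have [F0|//] := in_ultra_setVsetC [set n | f n = 0] FU.
  by case/eqP: f0; apply/hclass_eq.
rewrite hinv_class [LHS]hmul_class => f0; apply/hclass_eq.
by apply: filterS f0 => n /eqP; exact: mulVf.
Qed.

Lemma hinv0 : hinv 0 = 0.
Proof.
by rewrite [LHS]hinv_class; congr hclass; apply/funext=> n; rewrite invr0.
Qed.

HB.instance Definition _ := GRing.ComNzRing_isField.Build hyperreal hmulVf hinv0.

Lemma hle0_add x y : hle 0 x -> hle 0 y -> hle 0 (x + y).
Proof.
elim/hclassW: x => f; elim/hclassW: y => g /hle_class f0 /hle_class g0.
rewrite [_ + _]hadd_class; apply/hle_class.
by apply: filterS2 f0 g0 => n; exact: addr_ge0.
Qed.

Lemma hle0_mul x y : hle 0 x -> hle 0 y -> hle 0 (x * y).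
Proof.
elim/hclassW: x => f; elim/hclassW: y => g /hle_class f0 /hle_class g0.
rewrite [_ * _]hmul_class; apply/hle_class.
by apply: filterS2 f0 g0 => n; exact: mulr_ge0.
Qed.

Lemma hle0_anti x : hle 0 x -> hle x 0 -> x = 0.
Proof.
elim/hclassW: x => f /hle_class f0 /hle_class f1; apply/hclass_eq.
by apply: filterS2 f0 f1 => n ? ?; apply/eqP; rewrite eq_le; apply/andP.
Qed.

Lemma hsub_ge0 x y : hle 0 (y - x) = hle x y.
Proof.
elim/hclassW: x => f; elim/hclassW: y => g.
rewrite [- _]hopp_class [_ + _]hadd_class.
by apply/idP/idP => /hle_class H; apply/hle_class;
  apply: filterS H => n; rewrite subr_ge0.
Qed.

Lemma hle0_total x : hle 0 x || hle x 0.
Proof.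
elim/hclassW: x => f; apply/orP.
have [F0|F0] := in_ultra_setVsetC [set n | 0 <= f n] FU.
- by left; apply/hle_class.
- right; apply/hle_class; apply: filterS F0 => n /negP.
  by rewrite -ltNge => /ltW.
Qed.

Lemma habsN x : habs (- x) = habs x.
Proof.
elim/hclassW: x => f; rewrite [- _]hopp_class !habs_class; congr hclass.
by apply/funext=> n; rewrite normrN.
Qed.

Lemma hge0_abs x : hle 0 x -> habs x = x.
Proof.
elim/hclassW: x => f /hle_class f0; rewrite habs_class; apply/hclass_eq.
by apply: filterS f0 => n; exact: ger0_norm.
Qed.

Lemma hlt_def x y : hlt x y = (y != x) && hle x y.
Proof.
elim/hclassW: x => f; elim/hclassW: y => g; apply/idP/andP.
- move=> /hlt_class fg; split; last first.
    by apply/hle_class; apply: filterS fg => n /ltW.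
  apply/eqP => /hclass_eq gf.
  by have [n [+ gfn]] := filter_ex (filterI fg gf); rewrite gfn ltxx.
- move=> [/eqP gf /hle_class fg]; apply/hlt_class.
  have [F0|F0] := in_ultra_setVsetC [set n | g n = f n] FU.
    by case: gf; apply/hclass_eq.
  by apply: filterS2 fg F0 => n fgn /eqP gfn; rewrite lt_def gfn.
Qed.

HB.instance Definition _ := Num.IntegralDomain_isLeReal.Build hyperreal
  hle0_add hle0_mul hle0_anti hsub_ge0 hle0_total habsN hge0_abs hlt_def.

Definition hconst (r : R) : hyperreal := hclass (fun=> r).

Definition infinitesimal : set hyperreal :=
  [set e | forall r : R, 0 < r -> - hconst r < e < hconst r].

End Hyperreal.
Arguments infinitesimal R {F} FU.

(* Partial functions are represented by their graphs: this is the least class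
   containing the basic functions and closed under composition, primitive
   recursion and minimization. *)
Inductive partial_recursive :
    forall n : nat, (n.-tuple nat -> nat -> Prop) -> Prop :=
| PR_zero n : partial_recursive (fun (_ : n.-tuple nat) y => y = 0%N)
| PR_succ : partial_recursive (fun (v : 1.-tuple nat) y => y = (thead v).+1)
| PR_proj n (i : 'I_n) :
    partial_recursive (fun (v : n.-tuple nat) y => y = tnth v i)
| PR_comp n m (f : m.-tuple nat -> nat -> Prop)
    (g : 'I_m -> n.-tuple nat -> nat -> Prop) :
    partial_recursive f -> (forall i, partial_recursive (g i)) ->
    partial_recursive (fun v y =>
      exists w : m.-tuple nat, (forall i, g i v (tnth w i)) /\ f w y)
| PR_prec n (f : n.-tuple nat -> nat -> Prop)
    (g : n.+2.-tuple nat -> nat -> Prop) :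
    partial_recursive f -> partial_recursive g ->
    partial_recursive (fun (v : n.+1.-tuple nat) y =>
      exists u : nat -> nat, [/\ f [tuple of behead v] (u 0%N),
        forall i, (i < thead v)%N ->
          g [tuple of i :: u i :: behead v] (u i.+1)
      & y = u (thead v)])
| PR_mu n (f : n.+1.-tuple nat -> nat -> Prop) :
    partial_recursive f ->
    partial_recursive (fun (v : n.-tuple nat) y =>
      f [tuple of y :: v] 0%N /\
      forall i, (i < y)%N -> exists z, f [tuple of i :: v] z.+1).

Definition computable (h : nat -> nat) : Prop :=
  partial_recursive (fun (v : 1.-tuple nat) y => y = h (thead v)).

Definition bits_value (a : nat) (s : seq bool) : nat :=
  foldl (fun c (b : bool) => (c.*2 + b)%N) a s.

Lemma bits_value_rcons a s (b : bool) :
  bits_value a (rcons s b) = ((bits_value a s).*2 + b)%N.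
Proof. exact: foldl_rcons. Qed.

(* A string is coded by the number whose binary expansion is 1 followed by the
   string; this is a bijection onto the positive natural numbers. *)
Definition string_code (s : seq bool) : nat := bits_value 1 s.

Lemma string_code_inj : injective string_code.
Proof.
have pos s : (0 < string_code s)%N.
  by elim/last_ind: s => [//|s b IHs]; rewrite /string_code bits_value_rcons
    addn_gt0 double_gt0 IHs.
have gt1 s (b : bool) : (1 < string_code (rcons s b))%N.
  have := pos s; rewrite /string_code bits_value_rcons.
  by case: bits_value => // c _; rewrite doubleS.
elim/last_ind=> [|s b IHs]; elim/last_ind=> [|s' b' _] // E.
- by have := gt1 s' b'; rewrite -E.
- by have := gt1 s b; rewrite E.
move: E; rewrite /string_code !bits_value_rcons => E.
have bb : b = b' by move/(congr1 odd): E; rewrite !oddD !odd_double !oddb.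
by move: E; rewrite bb => /addIn /double_inj /IHs ->.
Qed.

(* A set is recursively enumerable when it is the domain of a partial recursive
   function. *)
Definition recursively_enumerable (X : set (seq bool * nat)) : Prop :=
  exists2 f : 2.-tuple nat -> nat -> Prop, partial_recursive f &
    forall s k, X (s, k) <-> exists y, f [tuple string_code s; k] y.

(* An infinite binary sequence x_1, x_2, ... is a function x : nat -> bool with
   x_n = x n.-1. *)
Definition cylinder (s : seq bool) : set (nat -> bool) :=
  [set x | mkseq x (size s) = s].

Definition generated_open (X : set (seq bool)) : set (nat -> bool) :=
  \bigcup_(s in X) cylinder s.

Definition cylinders : set (set (nat -> bool)) := range cylinder.

Definition binary_digits (R : realType) (t : R) :
    g_sigma_algebraType cylinders :=
  fun n : nat => odd (Num.truncn (2 ^+ n.+1 * t)).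

Section LebesgueSeq.
Context (R : realType).

Lemma measurable_binary_digit n :
  measurable [set t : R | odd (Num.truncn (2 ^+ n.+1 * t))].
Proof.
have c0 : (0 : R) < 2 ^+ n.+1 by rewrite exprn_gt0.
rewrite (_ : [set _ | _] = \bigcup_(m in [set m | odd m])
  [set` `[m%:R / 2 ^+ n.+1, m.+1%:R / 2 ^+ n.+1[%R]).
  by apply: bigcup_measurable => m _; exact: measurable_itv.
have E (t : R) m : (t \in `[m%:R / 2 ^+ n.+1, m.+1%:R / 2 ^+ n.+1[%R)
    = (m%:R <= 2 ^+ n.+1 * t < m.+1%:R).
  by rewrite in_itv /= ler_pdivrMr// ltr_pdivlMr// mulrC.
apply/seteqP; split => t /=.
  move=> ot; exists (Num.truncn (2 ^+ n.+1 * t)) => //=.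
  rewrite E truncn_itv// -truncn_le; apply: contraTT ot.
  by rewrite truncn_le truncn_floor => /negbTE ->.
by case=> m /= om; rewrite E => /truncn_def ->.
Qed.

Lemma measurable_cylinder_digits s :
  measurable (@binary_digits R @^-1` cylinder s).
Proof.
rewrite (_ : _ @^-1` _ = \bigcap_(i in `I_(size s))
    [set t | binary_digits t i = nth false s i]).
  apply: bigcap_measurableType => i _.
  case: (nth false s i); first exact: measurable_binary_digit.
  rewrite (_ : [set _ | _] =
      ~` [set t : R | odd (Num.truncn (2 ^+ i.+1 * t))]).
    by apply: measurableC; exact: measurable_binary_digit.
  by apply/seteqP; split => t /= /negP; [move=> + /negP|move=> /negbTE].
apply/seteqP; split => t /=.
  by move=> <- i /=; rewrite size_mkseq => ilt; rewrite nth_mkseq.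
move=> H; apply: (@eq_from_nth _ false); rewrite size_mkseq// => i ilt.
by rewrite nth_mkseq//; exact: H.
Qed.

Lemma measurable_binary_digits :
  measurable_fun [set: R] (@binary_digits R).
Proof.
apply: (@measurability _ _ R (g_sigma_algebraType cylinders) setT
  (@binary_digits R) cylinders) => // _ [_ [s _ <-] <-].
by rewrite setTI; exact: measurable_cylinder_digits.
Qed.

HB.instance Definition _ :=
  isMeasurableFun.Build _ _ _ _ (@binary_digits R) measurable_binary_digits.

(* The law of the binary digits of a uniform random real of [0, 1[; it is the
   probability measure giving cylinder s the value 2 ^- size s, see
   lebesgue_seq_cylinder. *)
Definition lebesgue_seq : set (g_sigma_algebraType cylinders) -> \bar R :=
  pushforward (mrestr (@lebesgue_measure R) (measurable_itv `[0, 1[))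
    (@binary_digits R).

Let lebesgue_seq0 : lebesgue_seq set0 = 0%E.
Proof. by rewrite /lebesgue_seq /pushforward preimage_set0 measure0. Qed.

Let lebesgue_seq_ge0 A : (0 <= lebesgue_seq A)%E.
Proof. by rewrite /lebesgue_seq /pushforward /mrestr. Qed.

Let lebesgue_seq_sigma_additive : semi_sigma_additive lebesgue_seq.
Proof.
rewrite /lebesgue_seq; apply: measure_semi_sigma_additive.
exact: measurable_binary_digits.
Qed.

HB.instance Definition _ := isMeasure.Build _ _ _ lebesgue_seq
  lebesgue_seq0 lebesgue_seq_ge0 lebesgue_seq_sigma_additive.

Lemma truncn_prefix (t : R) n : 0 <= t < 1 ->
  Num.truncn (2 ^+ n * t) =
  bits_value 0 (mkseq (binary_digits t) n).
Proof.
move=> /andP[t0 t1]; elim: n => [|n IHn].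
  by rewrite expr0 mul1r /=; apply: truncn_def; rewrite t0.
rewrite mkseqS bits_value_rcons -IHn /binary_digits.
set k := Num.truncn (2 ^+ n.+1 * t).
have kh : Num.truncn (2 ^+ n * t) = k./2.
  have c0 : 0 <= 2 ^+ n.+1 * t by rewrite mulr_ge0// exprn_ge0.
  have /andP[k1 k2] := truncn_itv c0; rewrite -/k in k1 k2.
  apply: truncn_def; rewrite -(ler_pM2l (ltr0n R 2)) -(ltr_pM2l (ltr0n R 2)).
  rewrite mulrA -exprS -!natrM; apply/andP; split.
    by apply: le_trans k1; rewrite ler_nat mul2n -{2}(odd_double_half k) leq_addl.
  apply: lt_le_trans k2 _; rewrite ler_nat mul2n doubleS.
  by rewrite -{1}(odd_double_half k); case: odd.
by rewrite kh addnC odd_double_half.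
Qed.

Lemma bits_value0_inj (s s' : seq bool) : size s = size s' ->
  bits_value 0 s =
  bits_value 0 s' -> s = s'.
Proof.
elim/last_ind: s s' => [|s b IHs]; elim/last_ind => [|s' b' _] //;
  rewrite ?size_rcons //.
case=> ss; rewrite !bits_value_rcons => E.
have bb : b = b'.
  by move/(congr1 odd): E; rewrite !oddD !odd_double !oddb.
rewrite bb in E *; move/addIn: E => /double_inj E.
by rewrite (IHs s').
Qed.

Lemma bits_value0_lt (s : seq bool) :
  (bits_value 0 s < 2 ^ size s)%N.
Proof.
elim/last_ind: s => [//|s b IHs]; rewrite bits_value_rcons size_rcons expnS mul2n.
by rewrite -ltn_half_double halfD odd_double /= doubleK; case: b; rewrite addn0.
Qed.

Lemma lebesgue_seq_cylinder s :
  lebesgue_seq (cylinder s) = (2 ^- size s)%:E.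
Proof.
set n := size s.
set k := bits_value 0 s.
have c0 : (0 : R) < 2 ^+ n by rewrite exprn_gt0.
have kn : k.+1%:R / 2 ^+ n <= 1 :> R.
  rewrite ler_pdivrMr// mul1r -natrX ler_nat; exact: bits_value0_lt.
rewrite /lebesgue_seq /pushforward /mrestr.
rewrite (_ : _ `&` _ = [set` `[k%:R / 2 ^+ n, k.+1%:R / 2 ^+ n[%R]).
  rewrite lebesgue_measure_itv /= lte_fin ltr_pM2r ?invr_gt0// ltr_nat ltnSn.
  by rewrite -EFinB -mulrBl -natrB// subSnn mul1r.
apply/seteqP; split => t /=.
- rewrite !in_itv /= => -[ts t01].
  rewrite ler_pdivrMr// ltr_pdivlMr// mulrC -truncn_eq; last first.
    by rewrite mulr_ge0 ?(ltW c0)//; case/andP: t01.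
  by rewrite truncn_prefix// ts.
- rewrite !in_itv /= => /andP[kt tk].
  have t01 : 0 <= t < 1.
    by rewrite (le_trans _ kt) ?divr_ge0 ?(ltW c0)// (lt_le_trans tk).
  split; last by [].
  apply: bits_value0_inj; first by rewrite size_mkseq.
  rewrite -truncn_prefix// -/k; apply: truncn_def.
  by rewrite mulrC -ler_pdivrMr// kt -ltr_pdivlMr.
Qed.

Let lebesgue_seq_setT : lebesgue_seq [set: _] = 1%E.
Proof.
have := lebesgue_seq_cylinder [::]; rewrite expr0 invr1 => <-.
by congr lebesgue_seq; apply/seteqP; split.
Qed.

HB.instance Definition _ := Measure_isProbability.Build _ _ _ lebesgue_seq
  lebesgue_seq_setT.

(* The convergence of the measures of the G k to 0 is witnessed by a computable
   modulus h. *)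
Definition constructively_null (S : set (nat -> bool)) : Prop :=
  exists (X : set (seq bool * nat)) (h : nat -> nat),
    let G k := generated_open [set s | X (s, k)] in
    [/\ recursively_enumerable X, computable h,
        S `<=` \bigcap_(k in [set k | (0 < k)%N]) G k
      & forall m k, (0 < k)%N -> (h m <= k)%N ->
          (lebesgue_seq (G k) <= (2 ^- m)%:E)%E].

Definition random_seq : set (nat -> bool) :=
  [set x | ~ exists2 S, constructively_null S & S x].

Definition random01 : set R :=
  [set limn [series (x i)%:R / 2 ^+ i.+1 : R]_i | x in random_seq].

End LebesgueSeq.
Arguments random01 R : clear implicits.

Fixpoint endpoints (K : realFieldType) (a0 b0 : K) (x : nat -> bool) (n : nat) :
    K * K :=
  if n is m.+1 then
    let: (a, b) := endpoints a0 b0 x m in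
    if x m then ((a + b) / 2, b) else (a, (a + b) / 2)
  else (a0, b0).

Definition dedekind_set (K : realFieldType) (a0 b0 : K) (x : nat -> bool) :
    set K :=
  \bigcap_n [set` `[(endpoints a0 b0 x n).1, (endpoints a0 b0 x n).2]%R].

Definition random_hyperreal (R : realType) (F : set_system nat)
    (FU : UltraFilter F) (a0 b0 : hyperreal R FU) : set (hyperreal R FU) :=
  \bigcup_(x in random_seq R) dedekind_set a0 b0 x.

(* Main.v *)
Require Import Defs.
From HB Require Import structures.
From mathcomp Require Import all_boot all_order all_algebra.
From mathcomp Require Import all_classical all_reals all_analysis.
From mathcomp Require Import ring lra.
Import Order.TTheory GRing.Theory Num.Theory numFieldNormedType.Exports.

(** The dyadic endpoints a_n, b_n of the bisection scheme started at 0 and 1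
    are rational, so in the hyperreals they are the standard reals a_n, b_n
    (endpoints_hconst), and b_n - a_n = 2 ^- n.  Let r be the real number with
    binary digits x; it lies in every [a_n, b_n].

    If d lies in every [a_n, b_n], then |d - r| <= 2 ^- n for all n, so d - r
    is infinitesimal (dedekind_set_infinitesimal).

    Conversely, a perturbation r + e with e infinitesimal stays in every
    [a_n, b_n] as soon as r is in the interior of each of these intervals; the
    inclusion would fail for a negative e if r were some a_n, or for a positive
    one if r were some b_n.  Now r = a_n exactly when the digits of x vanish
    from rank n on, and r = b_n exactly when they are all 1 from rank n on.  A
    random x excludes both cases (random_not_eventually_constant): an
    eventually constant x has a computable sequence of prefixes, and the
    cylinders over these prefixes form a constructive null cover of x
    (computable_prefixes_nonrandom).  The recursive enumerability of this cover
    is checked by programming in the partial recursive functions. *)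

Set Implicit Arguments.
Unset Strict Implicit.
Unset Printing Implicit Defensive.

Local Open Scope classical_set_scope.
Local Open Scope ring_scope.

(** * Total recursive functions *)

Definition recursive n (f : n.-tuple nat -> nat) : Prop :=
  partial_recursive (fun v y => y = f v).

Section Recursive.
Local Open Scope nat_scope.

(** A projection whose index is out of range reads the default value 0, so it is
    the zero function. *)
Lemma recursive_nth n i : recursive (fun v : n.-tuple nat => nth 0 v i).
Proof.
have [ilt|ige] := ltnP i n.
  have := PR_proj (Ordinal ilt); congr partial_recursive.
  by apply/funext => v; apply/funext => y; rewrite (tnth_nth 0).
have := PR_zero n; congr partial_recursive.
by apply/funext => v; apply/funext => y; rewrite nth_default// size_tuple.
Qed.

Lemma recursive_comp n m (f : m.-tuple nat -> nat)
    (g : 'I_m -> n.-tuple nat -> nat) :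
  recursive f -> (forall i, recursive (g i)) ->
  recursive (fun v => f [tuple g i v | i < m]).
Proof.
move=> rf rg; have := PR_comp rf rg; congr partial_recursive.
apply/funext => v; apply/funext => y; apply/propext; split.
  move=> [w [gw ->]]; congr f; apply: eq_from_tnth => i.
  by rewrite tnth_mktuple gw.
move=> ->; exists [tuple g i v | i < m]; split=> // i.
by rewrite tnth_mktuple.
Qed.

Lemma recursive_comp1 n (f : nat -> nat) (g : n.-tuple nat -> nat) :
  computable f -> recursive g -> recursive (fun v => f (g v)).
Proof.
move=> rf rg; have := @recursive_comp n _ _ (fun=> g) rf (fun=> rg).
by congr partial_recursive; apply/funext => v; rewrite /thead tnth_mktuple.
Qed.

(** Recursiveness of a function of two arguments, the arguments being read
    with a default value as in recursive_nth so that they can be composed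
    without building ordinals. *)
Definition computable2 (f : nat -> nat -> nat) : Prop :=
  recursive (fun v : 2.-tuple nat => f (nth 0 v 0) (nth 0 v 1)).

Lemma recursive_comp2 n (f : nat -> nat -> nat) (g h : n.-tuple nat -> nat) :
  computable2 f -> recursive g -> recursive h ->
  recursive (fun v => f (g v) (h v)).
Proof.
move=> rf rg rh.
pose gh (i : 'I_2) := if i == 0 :> nat then g else h.
have rgh i : recursive (gh i) by rewrite /gh; case: eqP.
have := recursive_comp rf rgh; congr partial_recursive.
apply/funext => v; apply/funext => y.
by rewrite -!(tnth_nth 0 _ (Ordinal _)) !tnth_mktuple.
Qed.

(** The sequence of intermediate values required by the primitive recursion
    clause exists and is unique, since f and g are total. *)
Lemma recursive_prec n (f : n.-tuple nat -> nat) (g : n.+2.-tuple nat -> nat)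
    (r : nat -> n.-tuple nat -> nat) :
    recursive f -> recursive g ->
    (forall v, r 0 v = f v) ->
    (forall i v, r i.+1 v = g [tuple of i :: r i v :: v]) ->
  recursive (fun v : n.+1.-tuple nat => r (thead v) [tuple of behead v]).
Proof.
move=> rf rg r0 rS; have := PR_prec rf rg; congr partial_recursive.
apply/funext => v; apply/funext => y; apply/propext; split.
  move=> [u [u0 uS ->]].
  suff H i : i <= thead v -> u i = r i [tuple of behead v] by exact: H.
  elim: i => [|i IHi] ilt; first by rewrite r0.
  by rewrite rS -IHi ?uS// ltnW.
by move=> ->; exists (fun i => r i [tuple of behead v]); split=> [|i _|];
  rewrite ?r0 ?rS.
Qed.

Lemma computable_succ : computable succn.
Proof. exact: PR_succ. Qed.

Lemma computable_id : computable id.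
Proof. exact: (PR_proj (ord0 : 'I_1)). Qed.

Lemma recursive_const n c : recursive (fun _ : n.-tuple nat => c).
Proof.
elim: c => [|c IHc]; first exact: PR_zero.
exact: recursive_comp1 computable_succ IHc.
Qed.

Lemma computable_iter (f : nat -> nat) c :
  computable f -> computable (fun k => iter k f c).
Proof.
move=> rf; apply: (@recursive_prec 0 (fun=> c)
  (fun v => f (nth 0 v 1)) (fun k _ => iter k f c)) => //.
- exact: recursive_const.
- by apply: recursive_comp1 rf _; exact: recursive_nth.
Qed.

Lemma computable_pred : computable predn.
Proof.
apply: (@recursive_prec 0 (fun=> 0) (fun v => nth 0 v 0) (fun k _ => k.-1)) => //.
- exact: recursive_const.
- exact: recursive_nth.
Qed.

Lemma computable2_iter (f : nat -> nat) :
  computable f -> computable2 (fun k c => iter k f c).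
Proof.
move=> rf.
have : recursive (fun v : 2.-tuple nat =>
    iter (thead v) f (nth 0 [tuple of behead v] 0)).
  apply: (@recursive_prec 1 (fun v => nth 0 v 0)
    (fun v => f (nth 0 v 1)) (fun k v => iter k f (nth 0 v 0))) => //.
  - exact: recursive_nth.
  - by apply: recursive_comp1 rf _; exact: recursive_nth.
congr partial_recursive; apply/funext => v; apply/funext => y.
by rewrite /thead (tnth_nth 0) /= nth_behead.
Qed.

Lemma computable2_add : computable2 addn.
Proof.
have := computable2_iter computable_succ; congr partial_recursive.
by apply/funext => v; apply/funext => y; rewrite iter_succn addnC.
Qed.

(** The recursion, an iterated predecessor, is on the subtracted argument,
    which therefore comes first. *)
Lemma computable2_subr : computable2 (fun m n => n - m).
Proof.
have := computable2_iter computable_pred; congr partial_recursive.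
by apply/funext => v; apply/funext => y; rewrite iter_predn.
Qed.

(** The distance between string_code s and c k is recursive and does not depend
    on the variable that is minimized, so the search for a zero of it stops, at
    once, exactly when the two numbers are equal. *)
Lemma recursively_enumerable_graph (c : nat -> nat) : computable c ->
  recursively_enumerable [set p | string_code p.1 = c p.2].
Proof.
move=> rc.
pose a (w : 3.-tuple nat) := nth 0 w 1.
pose b (w : 3.-tuple nat) := c (nth 0 w 2).
have ra : recursive a by exact: recursive_nth.
have rb : recursive b by apply: recursive_comp1 rc _; exact: recursive_nth.
have rdist : recursive (fun w => (b w - a w) + (a w - b w)).
  by apply: recursive_comp2 computable2_add _ _;
    apply: recursive_comp2 computable2_subr _ _.
(* The three entries of w are the minimized variable, string_code s and k. *)
apply: ex_intro2 (PR_mu rdist) _ => s k; rewrite /a /b /=; split=> [->|[y [+ _]]].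
  by exists 0; rewrite !subnn.
move/esym/eqP; rewrite addn_eq0 !subn_eq0 => ?.
by apply/eqP; rewrite eqn_leq andbC.
Qed.

End Recursive.

(** * Eventually constant sequences are not random *)

Section Random.
Context (R : realType).
Implicit Types x : nat -> bool.

(** The single prefix of length n + k is the k-th level of a test covering x;
    its cylinder has measure 2 ^- (n + k) <= 2 ^- k, so that the identity is a
    modulus of convergence.  The offset n is what makes the sequence of codes a
    plain iteration when x is constant from rank n on. *)
Lemma computable_prefixes_nonrandom x n :
  computable (fun k => string_code (mkseq x (n + k))) -> ~ random_seq R x.
Proof.
move=> rx; apply; exists [set x] => //.
exists [set p | string_code p.1 = string_code (mkseq x (n + p.2))], id => G.
have GE k : G k = cylinder (mkseq x (n + k)).
  rewrite /G /generated_open; apply/seteqP; split => [z [s /= + zs]|z zx].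
    by move/string_code_inj => <-.
  by exists (mkseq x (n + k)).
split.
- exact: (recursively_enumerable_graph rx).
- exact: computable_id.
- by move=> _ -> k _; rewrite GE /cylinder /= size_mkseq.
- move=> m k _ mk; rewrite GE lebesgue_seq_cylinder size_mkseq lee_fin.
  rewrite lef_pV2 ?posrE ?exprn_gt0// ler_eXn2l ?ltr1n//.
  by rewrite (leq_trans mk)// leq_addl.
Qed.

(** If all the digits from rank n on were equal to c = ~~ b, each code of a
    prefix would be obtained from the previous one by the recursive map
    k |-> 2 k + c. *)
Lemma random_not_eventually_constant x (b : bool) n : random_seq R x ->
  exists2 m, (n <= m)%N & x m = b.
Proof.
move=> xr; apply: contrapT => H; move: xr.
apply: (@computable_prefixes_nonrandom _ n).
have xb k : x (n + k)%N = ~~ b.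
  have [xb|] := eqVneq (x (n + k)%N) b.
    by case: H; exists (n + k)%N; rewrite ?leq_addr.
  by case: (x _) b {H} => -[].
pose f k := (k + k + ~~ b)%N.
rewrite (_ : (fun k => _) = fun k => iter k f (string_code (mkseq x n))).
  apply: computable_iter; rewrite /f.
  apply: recursive_comp2 computable2_add _ _; last exact: recursive_const.
  by apply: recursive_comp2 computable2_add _ _; exact: computable_id.
apply/funext; elim=> [|k IHk]; first by rewrite addn0.
by rewrite addnS mkseqS /string_code bits_value_rcons xb /= -IHk /f addnn.
Qed.

End Random.

(** * Endpoints of the bisection intervals *)

Section Endpoints.
Context (K : realFieldType).
Implicit Types x : nat -> bool.
Local Notation lo x n := (endpoints (0 : K) 1 x n).1.
Local Notation hi x n := (endpoints (0 : K) 1 x n).2.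

Lemma endpoints_length x n : hi x n = lo x n + 2 ^- n.
Proof.
elim: n => [|n IHn] /=; first by rewrite expr0 invr1 add0r.
case: endpoints IHn => a b /= ->; rewrite exprS invfM.
by case: (x n) => /=; field.
Qed.

Lemma endpoints_lo_succ x n : lo x n.+1 = lo x n + (x n)%:R / 2 ^+ n.+1.
Proof.
have /= := endpoints_length x n; case: endpoints => a b /= ->.
by rewrite exprS invfM; case: (x n) => /=; field.
Qed.

Lemma endpoints_hi_succ x n :
  hi x n.+1 = hi x n - (~~ x n)%:R / 2 ^+ n.+1.
Proof.
rewrite !endpoints_length endpoints_lo_succ exprS invfM.
by case: (x n) => /=; field.
Qed.

Lemma endpoints_lo_series x n :
  lo x n = series (fun i => (x i)%:R / 2 ^+ i.+1) n.
Proof.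
elim: n => [|n IHn]; first by rewrite seriesEnat /= big_nil.
by rewrite endpoints_lo_succ IHn seriesEnat /= big_nat_recr.
Qed.

Lemma endpoints_lo_nondecreasing x :
  {homo (fun n => lo x n) : m n / (m <= n)%N >-> m <= n}.
Proof.
apply: homo_leq => [//|? ? ?|n]; first exact: le_trans.
by rewrite endpoints_lo_succ lerDl divr_ge0 ?exprn_ge0.
Qed.

Lemma endpoints_hi_nonincreasing x :
  {homo (fun n => hi x n) : m n / (m <= n)%N >-> n <= m}.
Proof.
apply: homo_leq => [//|? ? ? xy yz|n]; first exact: le_trans yz xy.
by rewrite endpoints_hi_succ gerBl divr_ge0 ?exprn_ge0.
Qed.

Lemma endpoints_lo_le_hi x m n : lo x m <= hi x n.
Proof.
apply: (@le_trans _ _ (lo x (maxn m n))).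
  exact/endpoints_lo_nondecreasing/leq_maxl.
apply: (@le_trans _ _ (hi x (maxn m n))).
  by rewrite endpoints_length lerDl invr_ge0 exprn_ge0.
exact/endpoints_hi_nonincreasing/leq_maxr.
Qed.

End Endpoints.

(** * The real number with given binary digits *)

Section BinaryReal.
Context (R : realType).
Implicit Types x : nat -> bool.
Local Notation lo x n := (endpoints (0 : R) 1 x n).1.
Local Notation hi x n := (endpoints (0 : R) 1 x n).2.

Definition binary_real x : R := limn [series (x i)%:R / 2 ^+ i.+1 : R]_i.

Lemma binary_realE x : binary_real x = limn (fun n => lo x n).
Proof.
rewrite /binary_real; congr (lim (_ @ \oo)).
by apply/funext => n; rewrite endpoints_lo_series.
Qed.

Lemma is_cvg_endpoints_lo x : cvgn (fun n => lo x n).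
Proof.
apply: nondecreasing_is_cvgn; first exact: endpoints_lo_nondecreasing.
by exists (hi x 0) => _ [n _ <-]; exact: endpoints_lo_le_hi.
Qed.

Lemma binary_real_ge x n : lo x n <= binary_real x.
Proof.
rewrite binary_realE.
exact: nondecreasing_cvgn_le (@endpoints_lo_nondecreasing R x)
  (@is_cvg_endpoints_lo x) n.
Qed.

Lemma binary_real_le x n : binary_real x <= hi x n.
Proof.
rewrite binary_realE; apply: limr_le; first exact: is_cvg_endpoints_lo.
by apply: nearW => m; exact: endpoints_lo_le_hi.
Qed.

(** A later digit 1 moves the lower endpoint strictly to the right, and a later
    digit 0 moves the upper endpoint strictly to the left, while the real number
    stays between the two. *)
Lemma random_binary_real_itv x n : random_seq R x ->
  lo x n < binary_real x < hi x n.
Proof.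
move=> xr; apply/andP; split.
- have [m nm xm] := random_not_eventually_constant true n xr.
  apply: lt_le_trans (binary_real_ge x m.+1).
  apply: le_lt_trans (@endpoints_lo_nondecreasing R x _ _ nm) _.
  by rewrite endpoints_lo_succ xm ltrDl divr_gt0 ?exprn_gt0.
- have [m nm xm] := random_not_eventually_constant false n xr.
  apply: le_lt_trans (binary_real_le x m.+1) _.
  apply: lt_le_trans (@endpoints_hi_nonincreasing R x _ _ nm).
  by rewrite endpoints_hi_succ xm gtrBl divr_gt0 ?exprn_gt0.
Qed.

End BinaryReal.

(** * Hyperreal Dedekind sets *)

Section Hyperreal.
Context (R : realType) (F : set_system nat) (FU : UltraFilter F).
Local Notation hconst := (@hconst R F FU).
Implicit Types x : nat -> bool.

Lemma hconst_is_zmod_morphism : zmod_morphism hconst.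
Proof.
move=> r s; rewrite /Defs.hconst.
by rewrite [X in _ = _ + X]hopp_class [RHS]hadd_class.
Qed.

Lemma hconst_is_monoid_morphism : monoid_morphism hconst.
Proof. by split=> // r s; rewrite /Defs.hconst [RHS]hmul_class. Qed.

HB.instance Definition _ := GRing.isZmodMorphism.Build R (hyperreal R FU)
  hconst hconst_is_zmod_morphism.
HB.instance Definition _ := GRing.isMonoidMorphism.Build R (hyperreal R FU)
  hconst hconst_is_monoid_morphism.

Lemma hconst_le (r s : R) : r <= s -> hconst r <= hconst s.
Proof. by move=> rs; apply/hle_class; exact: nearW. Qed.

Lemma hconst_lt (r s : R) : r < s -> hconst r < hconst s.
Proof. by move=> rs; apply/hlt_class; exact: nearW. Qed.

Lemma endpoints_hconst x n : endpoints (0 : hyperreal R FU) 1 x n =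
  (hconst (endpoints 0 1 x n).1, hconst (endpoints 0 1 x n).2).
Proof.
elim: n => [|n IHn] /=; first by rewrite rmorph0 rmorph1.
rewrite IHn; case: (endpoints 0 1 x n) => a b /=.
by case: (x n); rewrite /= rmorphM rmorphD fmorphV rmorph_nat.
Qed.

(** Both d and the real number lie in an interval of standard length 2 ^- n, and
    the reals are archimedean. *)
Lemma dedekind_set_infinitesimal x (d : hyperreal R FU) :
  dedekind_set 0 1 x d -> infinitesimal R FU (d - hconst (binary_real R x)).
Proof.
move=> dx r r0.
have [n nr] : exists n, 2 ^- n < r.
  have [n] := filter_ex (near_infty_natSinv_expn_lt (PosNum r0)).
  by rewrite div1r => nr; exists n.
have := dx n I; rewrite endpoints_hconst /= in_itv /= => /andP[nd dn].
have lor := hconst_le (binary_real_ge R x n).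
have rhi := hconst_le (binary_real_le R x n).
have hn : hconst (endpoints 0 1 x n).2 =
    hconst (endpoints 0 1 x n).1 + hconst (2 ^- n).
  by rewrite endpoints_length rmorphD.
have := hconst_lt nr; rewrite hn in dn rhi => ?.
by apply/andP; split; lra.
Qed.

(** The distances from the real number to the endpoints of rank n are positive
    standard reals, which exceed every infinitesimal. *)
Lemma random_add_infinitesimal x (e : hyperreal R FU) :
  random_seq R x -> infinitesimal R FU e ->
  dedekind_set 0 1 x (hconst (binary_real R x) + e).
Proof.
move=> xr ei n _; rewrite endpoints_hconst /= in_itv /=.
have /andP[lor rhi] := random_binary_real_itv n xr.
have /andP[e1 _] := ei (_ - _) (etrans (subr_gt0 _ _) lor).
have /andP[_ e2] := ei (_ - _) (etrans (subr_gt0 _ _) rhi).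
by move: e1 e2; rewrite !rmorphB => e1 e2; apply/andP; split; lra.
Qed.

End Hyperreal.

Theorem mainTheorem2 (R : realType) (F : set_system nat)
    (FU : UltraFilter F) (Fnp : nonprincipal F) :
  random_hyperreal (0 : hyperreal R FU) 1 =
  [set hconst FU x + e | x in random01 R & e in infinitesimal R FU].
Proof.
apply/seteqP; split=> [d [x xr dx]|_ [_ [x xr <-] [e ei <-]]].
- exists (binary_real R x); first by exists x.
  exists (d - hconst FU (binary_real R x)).
    exact: dedekind_set_infinitesimal.
  by rewrite addrC subrK.
- by exists x => //; exact: random_add_infinitesimal.
Qed.
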